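(* Let $\mathfrak{g}$ and $\mathfrak{h}$ be two arbitrary Leibniz algebras. Then $\approx$ is an equivalence relation on the set $\mathcal{C}\mathcal{S}(\mathfrak{h},\mathfrak{g})$ of all crossed systems and the map $$\mathbb{H}\mathbb{L}^2(\mathfrak{h},\mathfrak{g}):=\mathcal{C}\mathcal{S}(\mathfrak{h},\mathfrak{g})/\approx\ \longrightarrow\ \mathcal{E}\mathcal{P}(\mathfrak{h},\mathfrak{g}),\qquad \overline{(\triangleright,\leftharpoonup,f)}\mapsto\mathfrak{g}\#_{\triangleright,\leftharpoonup}^f\mathfrak{h}$$ is a bijection of sets, where $\overline{(\triangleright,\leftharpoonup,f)}$ is the equivalence class of $(\triangleright,\leftharpoonup,f)$ via $\approx$.
   Context: All vector spaces, linear and bilinear maps are over an arbitrary field $k$. A Leibniz algebra is a vector space $\mathfrak{g}$ with a bilinear map $[-,-]$ satisfying $[g,[h,l]]=[[g,h],l]-[[g,l],h]$. Let $(\mathfrak{g},[-,-])$ and $(\mathfrak{h},\{-,-\})$ be Leibniz algebras. $\mathcal{C}\mathcal{S}(\mathfrak{h},\mathfrak{g})$ is the set of triples $(\triangleright,\leftharpoonup,f)$ of bilinear maps $\triangleright:\mathfrak{h}\times\mathfrak{g}\to\mathfrak{g}$, $\leftharpoonup:\mathfrak{g}\times\mathfrak{h}\to\mathfrak{g}$, $f:\mathfrak{h}\times\mathfrak{h}\to\mathfrak{g}$ such that $(\mathfrak{g},\mathfrak{h},\triangleright,\leftharpoonup,f)$ is a crossed system, i.e. for all $g,h\in\mathfrak{g}$,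 $x,y,z\in\mathfrak{h}$: (CS1) $[g,h]\leftharpoonup x=[g,h\leftharpoonup x]+[g\leftharpoonup x,h]$; (CS2) $g\leftharpoonup\{x,y\}=(g\leftharpoonup x)\leftharpoonup y-(g\leftharpoonup y)\leftharpoonup x-[g,f(x,y)]$; (CS3) $x\triangleright f(y,z)=f(x,y)\leftharpoonup z-f(x,z)\leftharpoonup y+f(\{x,y\},z)-f(\{x,z\},y)-f(x,\{y,z\})$; (CS4) $x\triangleright[g,h]=[x\triangleright g,h]-[x\triangleright h,g]$; (CS5) $\{x,y\}\triangleright g=x\triangleright(y\triangleright g)+(x\triangleright g)\leftharpoonup y-[f(x,y),g]$; (CS6) $[g,h\leftharpoonup x]+[g,x\triangleright h]=0$; (CS7) $x\triangleright(y\triangleright g)+x\triangleright(g\leftharpoonup y)=0$. The crossed product $\mathfrak{g}\#_{\triangleright,\leftharpoonup}^f\mathfrak{h}$ is the Leibniz algebra $\mathfrak{g}\times\mathfrak{h}$ with bracket $[(g,x),(h,y)]=([g,h]+x\triangleright h+g\leftharpoonup y+f(x,y),\ \{x,y\})$; it is an extension of $\mathfrak{h}$ by $\mathfrak{g}$ via $g\mapsto(g,0)$ and $(g,x)\mapsto x$. $(\triangleright,\leftharpoonup,f)\approx(\triangleright',\leftharpoonup',f')$ means that there is a linear map $r:\mathfrak{h}\to\mathfrak{g}$ such that for all $g\in\mathfrak{g}$, $x,y\in\mathfrak{h}$: $x\triangleright g=x\triangleright' g+[r(x),g]$; $g\leftharpoonup x=g\leftharpoonup' x+[g,r(x)]$;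 $f(x,y)=f'(x,y)+[r(x),r(y)]-r(\{x,y\})+r(x)\leftharpoonup' y+x\triangleright' r(y)$. An extension of $\mathfrak{h}$ by $\mathfrak{g}$ is a Leibniz algebra $\mathfrak{E}$ with an exact sequence of Leibniz algebra maps $0\to\mathfrak{g}\xrightarrow{i}\mathfrak{E}\xrightarrow{\pi}\mathfrak{h}\to0$. Two extensions $(\mathfrak{E},i,\pi)$, $(\mathfrak{E}',i',\pi')$ are equivalent if there is a Leibniz algebra isomorphism $\varphi:\mathfrak{E}\to\mathfrak{E}'$ with $\varphi\circ i=i'$ (stabilizes $\mathfrak{g}$) and $\pi'\circ\varphi=\pi$ (co-stabilizes $\mathfrak{h}$). $\mathcal{E}\mathcal{P}(\mathfrak{h},\mathfrak{g})$ is the set of equivalence classes of extensions of $\mathfrak{h}$ by $\mathfrak{g}$. *)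

(* Defs.v *)
From HB Require Import structures.
From Corelib Require Export RelationClasses.
From mathcomp Require Export all_boot all_algebra.

Set Implicit Arguments.
Unset Strict Implicit.
Unset Printing Implicit Defensive.

Import GRing.Theory.
Local Open Scope ring_scope.

Reserved Notation "{[ x , y ]}" (at level 0, format "{[ x ,  y ]}").
Reserved Notation "x ▷ a" (at level 41, no associativity).
Reserved Notation "a ↼ x" (at level 41, no associativity).

(* Equivalence classes as predicates, so that two classes are equal (up to
   functional and propositional extensionality) iff they have the same members. *)
Definition quotient (T : Type) (R : T -> T -> Prop) : Type :=
  {C : T -> Prop | exists x : T, C = R x}.

Definition eq_class (T : Type) (R : T -> T -> Prop) (x : T) : quotient R :=
  exist _ (R x) (ex_intro _ x erefl).

HB.mixin Record Lmodule_isLeibniz (k : fieldType) g of GRing.Lmodule k g := {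
  bracket : {bilinear g -> g -> g};
  bracket_leibniz : forall a b c : g,
    bracket a (bracket b c) = bracket (bracket a b) c - bracket (bracket a c) b
}.

#[short(type="leibnizType")]
HB.structure Definition Leibniz (k : fieldType) :=
  { g of GRing.Lmodule k g & Lmodule_isLeibniz k g }.

Notation "{[ x , y ]}" := (bracket x y) : ring_scope.

Definition leibniz_morphism (k : fieldType) (E E' : leibnizType k)
    (phi : {linear E -> E'}) : Prop :=
  {morph phi : u v / {[u, v]} >-> {[u, v]}}.

Section Extensions.
Variables (k : fieldType) (h g : leibnizType k).

Record extension := Extension {
  ext_alg : leibnizType k;
  ext_incl : {linear g -> ext_alg};
  ext_proj : {linear ext_alg -> h};
  ext_inclM : leibniz_morphism ext_incl;
  ext_projM : leibniz_morphism ext_proj;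
  ext_incl_inj : injective ext_incl;
  ext_exact : forall e : ext_alg, ext_proj e = 0 <-> exists a : g, e = ext_incl a;
  ext_proj_surj : forall x : h, exists e : ext_alg, ext_proj e = x
}.

Definition ext_equiv (E E' : extension) : Prop :=
  exists phi : {linear ext_alg E -> ext_alg E'},
    [/\ leibniz_morphism phi, bijective phi,
        forall a : g, phi (ext_incl E a) = ext_incl E' a
      & forall e : ext_alg E, ext_proj E' (phi e) = ext_proj E e].

Lemma ext_equiv_equivalence : Equivalence ext_equiv.
Proof.
split.
- by move=> E; exists idfun; split=> //; exists idfun.
- move=> E E' [phi [phiM [psi phiK psiK] phi_i phi_p]].
  have psi_lin : linear psi.
    by move=> c u v; apply: (can_inj phiK); rewrite linearP !psiK.
  pose psiL := GRing.isLinear.Build k (ext_alg E') (ext_alg E) *:%R psi psi_lin.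
  pose psi' : {linear ext_alg E' -> ext_alg E} := HB.pack psi psiL.
  exists psi'; split.
  + by move=> u v; apply: (can_inj phiK); rewrite psiK phiM !psiK.
  + by exists phi.
  + by move=> a; rewrite -phi_i; exact: phiK.
  + by move=> e; rewrite -phi_p; congr (ext_proj _ _); exact: psiK.
- move=> E1 E2 E3 [phi [phiM phi_bij phi_i phi_p]] [psi [psiM psi_bij psi_i psi_p]].
  exists (psi \o phi); split.
  + by move=> u v /=; rewrite phiM psiM.
  + exact: bij_comp.
  + by move=> a /=; rewrite phi_i.
  + by move=> e /=; rewrite psi_p.
Qed.

Definition EP : Type := quotient ext_equiv.

End Extensions.

Section CrossedSystems.
Variables (k : fieldType) (h g : leibnizType k).

Section CrossedSystemDef.
Variables (tr : h -> g -> g) (hl : g -> h -> g) (f : h -> h -> g).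
Local Notation "x ▷ a" := (tr x a).
Local Notation "a ↼ x" := (hl a x).

Record is_crossed_system : Prop := IsCrossedSystem {
  CS1 : forall (a b : g) (x : h),
    ({[a, b]} ↼ x) = {[a, (b ↼ x)]} + {[(a ↼ x), b]};
  CS2 : forall (a : g) (x y : h),
    (a ↼ {[x, y]}) = ((a ↼ x) ↼ y) - ((a ↼ y) ↼ x) - {[a, f x y]};
  CS3 : forall x y z : h,
    (x ▷ f y z) = (f x y ↼ z) - (f x z ↼ y)
                   + f {[x, y]} z - f {[x, z]} y - f x {[y, z]};
  CS4 : forall (x : h) (a b : g),
    (x ▷ {[a, b]}) = {[(x ▷ a), b]} - {[(x ▷ b), a]};
  CS5 : forall (x y : h) (a : g),
    ({[x, y]} ▷ a) = (x ▷ (y ▷ a)) + ((x ▷ a) ↼ y) - {[f x y, a]};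
  CS6 : forall (a b : g) (x : h), {[a, (b ↼ x)]} + {[a, (x ▷ b)]} = 0;
  CS7 : forall (x y : h) (a : g), (x ▷ (y ▷ a)) + (x ▷ (a ↼ y)) = 0
}.
End CrossedSystemDef.

Record crossed_system := CrossedSystem {
  cs_tr : {bilinear h -> g -> g};
  cs_hl : {bilinear g -> h -> g};
  cs_f : {bilinear h -> h -> g};
  cs_axioms : is_crossed_system cs_tr cs_hl cs_f
}.

Definition cs_equiv (s s' : crossed_system) : Prop :=
  exists r : {linear h -> g},
    [/\ forall (x : h) (a : g), cs_tr s x a = cs_tr s' x a + {[r x, a]},
        forall (a : g) (x : h), cs_hl s a x = cs_hl s' a x + {[a, r x]}
      & forall x y : h,
          cs_f s x y = cs_f s' x y + {[r x, r y]} - r {[x, y]}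
                       + cs_hl s' (r x) y + cs_tr s' x (r y)].

Definition HL2 : Type := quotient cs_equiv.

(* An alias for g * h, so that each crossed system gets its own bracket. *)
Definition crossed_product (s : crossed_system) : Type := (g * h)%type.

HB.instance Definition _ (s : crossed_system) :=
  GRing.Lmodule.on (crossed_product s).

Section CrossedProduct.
Variable s : crossed_system.
Local Notation P := (crossed_product s).
Local Notation "x ▷ a" := (cs_tr s x a).
Local Notation "a ↼ x" := (cs_hl s a x).

Definition cp_bracket (u v : P) : P :=
  ({[u.1, v.1]} + (u.2 ▷ v.1) + (u.1 ↼ v.2) + cs_f s u.2 v.2, {[u.2, v.2]}).

Lemma cp_bracket_bilinear : bilinear_for *:%R *:%R cp_bracket.
Proof.
have addrA4 (a b c d a' b' c' d' : g) :
    a + a' + (b + b') + (c + c') + (d + d')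
    = a + b + c + d + (a' + b' + c' + d').
  by rewrite (addrACA a) (addrACA (a + b)) (addrACA (a + b + c)).
split=> w c u v; congr (_, _); rewrite /= ?linearPl ?linearPr // !scalerDr;
  exact: addrA4.
Qed.

HB.instance Definition _ :=
  bilinear_isBilinear.Build k P P P *:%R *:%R cp_bracket cp_bracket_bilinear.

Lemma cp_bracket_leibniz (u v w : P) :
  cp_bracket u (cp_bracket v w) =
  cp_bracket (cp_bracket u v) w - cp_bracket (cp_bracket u w) v.
Proof.
have [H1 H2 H3 H4 H5 H6 H7] := cs_axioms s.
case: u v w => [a x] [b y] [c z]; congr (_, _) => /=; last exact: bracket_leibniz.
have H6' d e t : {[d, e ↼ t]} = - {[d, t ▷ e]} by apply/eqP; rewrite -addr_eq0 H6.
have H7' t t' d : t ▷ (d ↼ t') = - (t ▷ (t' ▷ d)).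
  by apply/eqP; rewrite -addr_eq0 addrC H7.
rewrite !(linearDl, linearDr) /= bracket_leibniz H2 H3 H4 !H5 !H1 !H6' !H7'.
rewrite -[LHS]add0r -[RHS]add0r.
repeat match goal with
| |- context [_ + (_ + _)] => rewrite addrA
| |- context [- (_ + _)] => rewrite opprD
| |- context [- - _] => rewrite opprK
end.
(* Abstract the summands, for speed, then cancel each pair t, - t. *)
repeat match goal with
| |- context [_ - ?t] => assert_fails (is_var t); move: t => ?
| |- context [_ + ?t] =>
    assert_fails (is_var t);
    lazymatch t with - _ => fail | _ => move: t => ? end
end.
clear; apply/eqP; rewrite -subr_eq0 !(opprD, opprK, addrA, oppr0, addr0).
repeat match goal with |- context [- ?t] =>
  rewrite ?[_ + - t + _]addrAC ?[_ + t + _]addrAC ?addrK ?addrNK end.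
exact: eqxx.
Qed.

HB.instance Definition _ :=
  Lmodule_isLeibniz.Build k P cp_bracket_leibniz.

Definition cp_incl (a : g) : P := (a, 0).
Definition cp_proj (u : P) : h := u.2.

Lemma cp_incl_linear : linear cp_incl.
Proof. by move=> c a b; congr (_, _); rewrite /= scaler0 addr0. Qed.

HB.instance Definition _ :=
  GRing.isLinear.Build k g P *:%R cp_incl cp_incl_linear.

Lemma cp_proj_linear : linear cp_proj.
Proof. by []. Qed.

HB.instance Definition _ :=
  GRing.isLinear.Build k P h *:%R cp_proj cp_proj_linear.

Lemma cp_inclM : leibniz_morphism cp_incl.
Proof.
by move=> a b; congr (_, _); rewrite /= ?(linear0l, linear0r) ?addr0.
Qed.

Lemma cp_projM : leibniz_morphism cp_proj.
Proof. by []. Qed.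

Lemma cp_incl_inj : injective cp_incl.
Proof. by move=> a b []. Qed.

Lemma cp_exact (u : P) : cp_proj u = 0 <-> exists a : g, u = cp_incl a.
Proof.
split=> [|[a ->] //].
by case: u => a x; rewrite /cp_proj /= => ->; exists a.
Qed.

Lemma cp_proj_surj (x : h) : exists u : P, cp_proj u = x.
Proof. by exists (0, x). Qed.

Definition cp_extension : extension h g :=
  Extension cp_inclM cp_projM cp_incl_inj cp_exact cp_proj_surj.

End CrossedProduct.
End CrossedSystems.

Arguments EP {k} h g.
Arguments HL2 {k} h g.

(* Main.v *)
(** Writing [phi (0, x) = (r x, x)], an equivalence from [g # h] to [g #' h] is
    the same thing as a linear map [r : h -> g] satisfying the three identities
    of [cs_equiv]. Conversely, a linear section [s] of the projection of an
    extension [E], together with the retraction of [E] onto [g] along [s h],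
    turns the bracket of [E] into the three maps of a crossed system, and
    [(a, x) |-> a + s x] is an equivalence of its crossed product with [E].
    Linear sections exist in arbitrary dimension by Zorn's lemma. *)
From mathcomp Require Import boolp classical_sets.
Require Import Defs.
From HB Require Import structures.
From mathcomp Require Import all_boot all_algebra.

Set Implicit Arguments.
Unset Strict Implicit.
Unset Printing Implicit Defensive.

Import GRing.Theory.
Local Open Scope ring_scope.

(** * Bijections between quotients *)

Lemma eq_class_eqP (T : Type) (R : T -> T -> Prop) (eqR : Equivalence R)
    (x y : T) :
  eq_class R x = eq_class R y <-> R x y.
Proof.
split=> [[->]|Rxy]; first exact: Equivalence_Reflexive.
apply/eq_exist/funext => z; apply/propext.
by split; apply: Equivalence_Transitive => //; apply: Equivalence_Symmetric.
Qed.

(** [F] applies [m] to a chosen representative: one direction of the equivalence makes the choice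
    irrelevant, the other gives injectivity. *)
Lemma quotient_bijection (T U : Type) (R : T -> T -> Prop) (S : U -> U -> Prop)
    (m : T -> U) :
    Equivalence R -> Equivalence S ->
    (forall x y, R x y <-> S (m x) (m y)) ->
    (forall u, exists x, S (m x) u) ->
  exists F : quotient R -> quotient S,
    (forall x, F (eq_class R x) = eq_class S (m x)) /\ bijective F.
Proof.
move=> eqR eqS mP m_surj.
have class_surj V (Q : V -> V -> Prop) (C : quotient Q) :
    exists x, eq_class Q x = C.
  by case: C => C [x Cx]; exists x; apply: eq_exist.
have [rep repK] := choice (@class_surj T R).
pose F C := eq_class S (m (rep C)).
have FE x : F (eq_class R x) = eq_class S (m x).
  by apply/(eq_class_eqP eqS)/mP/(eq_class_eqP eqR)/repK.
exists F; split=> //.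
have F_surj D : exists C, F C = D.
  have [u <-] := class_surj U S D; have [x Sxu] := m_surj u.
  by exists (eq_class R x); rewrite FE; apply/(eq_class_eqP eqS).
have [G GK] := choice F_surj.
(* The right inverse [G] is also a left inverse, by injectivity of [F] applied to
   [F (G (F C)) = F C]. *)
exists G => // C; have := GK (F C).
have [[x <-] [y <-]] := (class_surj T R C, class_surj T R (G (F C))).
by rewrite !FE => /(eq_class_eqP eqS)/mP/(eq_class_eqP eqR).
Qed.

(** * Linear sections of surjections *)

Section LinearSection.
Variables (k : fieldType) (E H : lmodType k) (p : {linear E -> H}).

(* Linear sections on subspaces of [H], encoded by their images in [E]; the
   empty set is allowed, so that every chain, even empty, has its union as an
   upper bound. *)
Definition partial_section (V : set E) : Prop :=
  (forall c u v, V u -> V v -> V (c *: u + v)) /\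
  (forall v, V v -> p v = 0 -> v = 0).

Lemma maximal_partial_section :
  exists V : set E, partial_section V /\
    forall W, (V `<=` W)%classic -> partial_section W -> (W `<=` V)%classic.
Proof.
have [|V [PV maxV]] := Zorn_bigcup (P := partial_section).
  move=> F FP Ftot; split=> [c u v [A FA Au] [B FB Bv]|v [A FA Av]].
    have [AB|BA] := Ftot A B FA FB.
    - by exists B => //; apply: (FP B FB).1 => //; exact: AB.
    - by exists A => //; apply: (FP A FA).1 => //; exact: BA.
  exact: (FP A FA).2.
exists V; split=> // W VW PW; apply: contrapT => WV.
by apply: (maxV W).
Qed.

(** On a maximal [V] the map [p] restricts to a bijection onto [H], and [s] is its inverse. *)
Lemma linear_section :
  (forall x, exists e, p e = x) -> exists s : {linear H -> E}, cancel s p.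
Proof.
move=> p_surj; have [V [[Vlin Vinj] maxV]] := maximal_partial_section.
have V0 : V 0.
  apply: (maxV (V `|` [set 0])%classic); [by move=> v; left| |by right].
  split=> [c u v|v [/Vinj//|->//]].
  move=> [Vu|->] [Vv|->]; rewrite ?scaler0 ?add0r ?addr0.
  - by left; apply: Vlin.
  (* As [0] is not yet known to lie in [V], [c *: u] is written as [(c - 1) *: u + u]. *)
  - by left; rewrite -[c *: u](subrK u) -{2}[u]scale1r -scalerBl; apply: Vlin.
  - by left.
  - by right.
have VZ c v : V v -> V (c *: v) by move=> Vv; rewrite -[_ *: _]addr0; apply: Vlin.
have VD u v : V u -> V v -> V (u + v).
  by move=> Vu Vv; rewrite -[u]scale1r; apply: Vlin.
have sP x : exists v, V v /\ p v = x.
  apply: contrapT => Vx; have [e pe] := p_surj x.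
  (* If [x] is not in [p V], adjoining the line through [e] enlarges [V]. *)
  pose W : set E := fun w => exists c, V (w - c *: e).
  have VW : (V `<=` W)%classic by move=> v Vv; exists 0; rewrite scale0r subr0.
  have PW : partial_section W.
    split=> [c u v [a Va] [b Vb]|w [c Vc] pw].
      exists (c * a + b); rewrite scalerDl -scalerA opprD addrACA -scalerBr.
      exact: Vlin.
    have [c0|c_neq0] := eqVneq c 0.
      by apply: Vinj => //; move: Vc; rewrite c0 scale0r subr0.
    (* Since [p w = 0], this vector of [V] is mapped to [p e = x], a contradiction. *)
    case: Vx; exists ((- c^-1) *: (w - c *: e)); split; first exact: VZ.
    by rewrite linearZ linearB linearZ /= pw pe sub0r scaleNr scalerN opprK scalerA
      mulVf // scale1r.
  apply: Vx; exists e; split=> //; apply: maxV PW _ _ => //.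
  by exists 1; rewrite scale1r subrr.
have [s sV] := choice sP.
have s_lin : linear s.
  (* The defect of linearity lies in [V] and is killed by [p]. *)
  move=> c x y; apply/eqP; rewrite -subr_eq0; apply/eqP/Vinj.
    rewrite -scaleN1r; apply: VD; first exact: (sV _).1.
    by apply/VZ/Vlin; exact: (sV _).1.
  by rewrite linearB linearP /= !(sV _).2 subrr.
pose sL := GRing.isLinear.Build k H E *:%R s s_lin.
pose s' : {linear H -> E} := HB.pack s sL.
by exists s' => x; exact: (sV x).2.
Qed.

End LinearSection.

(** * From extensions to crossed systems *)

Section BilinearComposition.
Variables (k : fieldType) (U1 U2 V1 V2 W W' : lmodType k).
Variables (B : {bilinear V1 -> V2 -> W}) (l : {linear W -> W'}).
Variables (u1 : {linear U1 -> V1}) (u2 : {linear U2 -> V2}).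

(** All three maps of the crossed system of an extension have this shape, so bilinearity is proved
    once. *)
Definition bilin_comp (x : U1) (y : U2) : W' := l (B (u1 x) (u2 y)).

Lemma bilin_comp_bilinear : bilinear_for *:%R *:%R bilin_comp.
Proof.
split=> w c x y; rewrite /bilin_comp.
  by rewrite linearP linearPl linearP.
by rewrite linearP linearPr linearP.
Qed.

HB.instance Definition _ := bilinear_isBilinear.Build k U1 U2 W' *:%R *:%R
  bilin_comp bilin_comp_bilinear.

End BilinearComposition.

(** The right side of the Leibniz identity is antisymmetric in its last two arguments; this is the
    source of [CS6] and [CS7]. *)
Lemma bracket_comm_r (k : fieldType) (E : leibnizType k) (u v w : E) :
  {[u, {[v, w]}]} + {[u, {[w, v]}]} = 0.
Proof. by rewrite !bracket_leibniz addrA subrK subrr. Qed.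

(** The form [CS3] takes inside [E]: [a], [b], [c], [d] are corrections, due to the section not
    preserving brackets, that cancel. *)
Lemma subr_telescope (V : zmodType) (p q r a b c d : V) :
  p - q - r = p - a - (q - b) + (a - c) - (b - d) - (r - (c - d)).
Proof.
have subBB (x y z t : V) : x - y - (z - t) = x - z - (y - t).
  by rewrite opprD addrACA -opprD.
rewrite (subBB p) -(addrA (p - q - _)) (subBB a) (addrA (p - q - _)) subrK.
by rewrite (opprB r) addrA subrK.
Qed.

Section CrossedSystemOfExtension.
Variables (k : fieldType) (h g : leibnizType k) (E : extension h g).
Local Notation i := (ext_incl E).
Local Notation p := (ext_proj E).

Lemma ext_projK (a : g) : p (i a) = 0.
Proof. by apply/ext_exact; exists a. Qed.

Variables (s : {linear h -> ext_alg E}) (sK : cancel s p).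

(** [e - s (p e)] lies in the kernel of [p], the image of [i]; injectivity of [i] makes [q]
    linear. *)
Lemma ext_retraction :
  exists q : {linear ext_alg E -> g}, forall e, i (q e) = e - s (p e).
Proof.
have ex_q e : exists a, i a = e - s (p e).
  have /ext_exact[a ->] : p (e - s (p e)) = 0 by rewrite linearB /= sK subrr.
  by exists a.
have [q qP] := choice ex_q.
have q_lin : linear q.
  move=> c u v; apply: (@ext_incl_inj _ _ _ E).
  by rewrite linearP /= !qP (linearP p) (linearP s) /= scalerBr opprD addrACA.
pose qL := GRing.isLinear.Build k (ext_alg E) g *:%R q q_lin.
pose q' : {linear ext_alg E -> g} := HB.pack q qL.
by exists q'.
Qed.

Variables (q : {linear ext_alg E -> g}) (qP : forall e, i (q e) = e - s (p e)).

Definition ext_tr : {bilinear h -> g -> g} := bilin_comp bracket q s i.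
Definition ext_hl : {bilinear g -> h -> g} := bilin_comp bracket q i s.
Definition ext_f : {bilinear h -> h -> g} := bilin_comp bracket q s s.

Lemma incl_tr x a : i (ext_tr x a) = {[s x, i a]}.
Proof. by rewrite qP ext_projM ext_projK linear0r linear0 subr0. Qed.

Lemma incl_hl a x : i (ext_hl a x) = {[i a, s x]}.
Proof. by rewrite qP ext_projM ext_projK linear0l linear0 subr0. Qed.

Lemma incl_f x y : i (ext_f x y) = {[s x, s y]} - s {[x, y]}.
Proof. by rewrite qP ext_projM !sK. Qed.

(** Through the injection [i], each axiom becomes an identity in [E]; the first five follow from the
    Leibniz identity. *)
Lemma ext_crossed_system : is_crossed_system ext_tr ext_hl ext_f.
Proof.
pose inclE := (incl_tr, incl_hl, incl_f, @ext_inclM _ _ _ E).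
split=> *; apply: (@ext_incl_inj _ _ _ E);
  rewrite ?(linearD, linearN, linear0) /= ?linearN /= !inclE ?(linearBl, linearBr) /=.
- by rewrite bracket_leibniz subrK.
- by rewrite -bracket_leibniz subKr.
- rewrite bracket_leibniz [{[_, {[_, _]}]} as X in s X]bracket_leibniz (linearB s) /=.
  exact: subr_telescope.
- exact: bracket_leibniz.
- by rewrite bracket_leibniz subrK subKr.
- exact: bracket_comm_r.
- exact: bracket_comm_r.
Qed.

Lemma cp_extension_ext :
  ext_equiv (cp_extension (CrossedSystem ext_crossed_system)) E.
Proof.
pose phi (u : crossed_product (CrossedSystem ext_crossed_system)) : ext_alg E :=
  i u.1 + s u.2.
have phi_lin : linear phi.
  by move=> c u v; rewrite /phi /= !linearP scalerDr addrACA.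
have p_phi u : p (phi u) = u.2 by rewrite linearD /= ext_projK sK add0r.
pose phiL := GRing.isLinear.Build k _ (ext_alg E) *:%R phi phi_lin.
pose phi' : {linear crossed_product (CrossedSystem ext_crossed_system) -> ext_alg E} :=
  HB.pack phi phiL.
exists phi'; split=> //=.
- move=> u v; rewrite /= /phi /= !linearD /= incl_tr incl_hl incl_f ext_inclM.
  by rewrite !linearDl /= !addrA subrK.
- exists (fun e => (q e, p e)) => [u|e]; rewrite /= /phi.
    rewrite -/(phi u) p_phi; case: u => a x /=; congr (_, _).
    by apply: (@ext_incl_inj _ _ _ E); rewrite qP p_phi addrK.
  by rewrite /= qP subrK.
- by move=> a; rewrite /= /phi /= linear0 addr0.
Qed.

End CrossedSystemOfExtension.

(** * Equivalences between crossed products *)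

Section CrossedProductEquivalence.
Variables (k : fieldType) (h g : leibnizType k) (s s' : crossed_system h g).

Lemma cs_equiv_ext_equiv :
  cs_equiv s s' -> ext_equiv (cp_extension s) (cp_extension s').
Proof.
case=> r [r_tr r_hl r_f].
pose phi (u : crossed_product s) : crossed_product s' := (u.1 + r u.2, u.2).
have phi_lin : linear phi.
  by move=> c u v; congr (_, _); rewrite /= linearP scalerDr addrACA.
pose phiL := GRing.isLinear.Build k _ (crossed_product s') *:%R phi phi_lin.
pose phi' : {linear crossed_product s -> crossed_product s'} := HB.pack phi phiL.
exists phi'; split=> //=.
- move=> [a x] [b y]; congr (_, _); rewrite /= r_tr r_hl r_f.
  rewrite !linearDl /= !linearDr /= !addrA.
  (* The summands are regrouped as in the bracket of [(a + r x, x)] and [(b + r y, y)]; the last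
     group is [- r {[x, y]} + r {[x, y]}]. *)
  rewrite [LHS](ACl (1*5*(3*7)*(2*10)*(4*9)*6*(8*11)))%AC /=.
  by rewrite addNr addr0 !addrA.
- exists (fun u => (u.1 - r u.2, u.2)) => [] [a x]; congr (_, _) => /=.
    exact: addrK.
  exact: subrK.
- by move=> a; congr (_, _); rewrite /= linear0 addr0.
Qed.

Lemma ext_equiv_cs_equiv :
  ext_equiv (cp_extension s) (cp_extension s') -> cs_equiv s s'.
Proof.
case=> phi [phiM _ phi_i phi_p].
pose r x := (phi (0, x)).1.
have phi_r x : phi (0, x) = (r x, x).
  by rewrite [LHS]surjective_pairing; congr (_, _); exact: (phi_p (0, x)).
have phi_g a : phi (a, 0) = (a, 0) := phi_i a.
have phiE a x : phi (a, x) = (a + r x, x).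
  have -> : (a, x) = (a, 0) + (0, x) :> crossed_product s.
    by congr (_, _); rewrite /= ?addr0 ?add0r.
  by rewrite linearD /= phi_g phi_r; congr (_, _); rewrite /= add0r.
have r_lin : linear r.
  move=> c x y; rewrite /r.
  have -> : (0, c *: x + y) = c *: (0, x) + (0, y) :> crossed_product s.
    by congr (_, _); rewrite /= scaler0 addr0.
  by rewrite linearP.
pose rL := GRing.isLinear.Build k h g *:%R r r_lin.
pose r' : {linear h -> g} := HB.pack r rL.
have r0 : r 0 = 0 := linear0 r'.
have bracketE (t : crossed_system h g) (a b : g) (x y : h) :
    {[(a, x) : crossed_product t, (b, y) : crossed_product t]} =
    ({[a, b]} + cs_tr t x b + cs_hl t a y + cs_f t x y, {[x, y]}) by [].
exists r'; split.
(* The three identities are multiplicativity of [phi] on pairs of vectors from the two factors. *)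
- move=> x a; have := phiM (0, x) (a, 0).
  rewrite phi_r phi_g !bracketE phiE !(linear0l, linear0r) /= !(r0, add0r, addr0).
  by case=> ->; rewrite addrC.
- move=> a x; have := phiM (a, 0) (0, x).
  rewrite phi_r phi_g !bracketE phiE !(linear0l, linear0r) /= !(r0, add0r, addr0).
  by case=> ->; rewrite addrC.
- move=> x y; have := phiM (0, x) (0, y).
  rewrite !phi_r !bracketE phiE !(linear0l, linear0r) /= !(r0, add0r, addr0).
  case=> /(canRL (addrK _)) ->.
  exact: (ACl (4*1*5*3*2))%AC.
Qed.

End CrossedProductEquivalence.

Theorem corollary4p2 (k : fieldType) (g h : leibnizType k) :
  Equivalence (@cs_equiv k h g) /\
  exists F : HL2 h g -> EP h g,
    (forall s : crossed_system h g,
       F (eq_class (@cs_equiv k h g) s)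
         = eq_class (@ext_equiv k h g) (cp_extension s))
    /\ bijective F.
Proof.
have eqE := @ext_equiv_equivalence k h g.
have csP (s s' : crossed_system h g) :
    cs_equiv s s' <-> ext_equiv (cp_extension s) (cp_extension s').
  by split; [exact: cs_equiv_ext_equiv | exact: ext_equiv_cs_equiv].
(* [cs_equiv] is the pullback of [ext_equiv] along [cp_extension], so it inherits the three
   properties. *)
have eqCS : Equivalence (@cs_equiv k h g).
  split=> [s|s t /csP st|s t u /csP st /csP tu]; apply/csP.
  - exact: Equivalence_Reflexive.
  - exact: Equivalence_Symmetric.
  - exact: Equivalence_Transitive tu.
split=> //; apply: quotient_bijection => // E.
have [s sK] := linear_section (ext_proj_surj E).
have [q qP] := ext_retraction sK.
by exists (CrossedSystem (ext_crossed_system sK qP)); exact: cp_extension_ext.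
Qed.
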